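(* Let $B>4$ and $U\ge 1$ be integers, let $N_0\ge 0$ and $E_s>0$, and let $\mathbf{H}\in\mathbb{C}^{B\times U}$ have i.i.d.\ circularly symmetric complex Gaussian entries with zero mean and unit variance. Let $\mathbf{A}=\mathbf{H}^H\mathbf{H}+N_0E_s^{-1}\mathbf{I}_U$, let $\mathbf{D}$ be the diagonal matrix with the same diagonal as $\mathbf{A}$, and let $\mathbf{E}=\mathbf{A}-\mathbf{D}$. Then for every integer $K\ge 1$ and every $\alpha>0$, \[ \Pr\left\{\|\mathbf{D}^{-1}\mathbf{E}\|_F^K<\alpha\right\}\;\ge\;1-\frac{U^2-U}{\alpha^{2/K}}\sqrt{\frac{2B(B+1)}{(B-1)(B-2)(B-3)(B-4)}}. \]
   Context: $\|\cdot\|_F$ denotes the Frobenius norm and $\mathbf{H}^H$ the conjugate transpose. The diagonal entries of $\mathbf{A}$ are almost surely positive, so $\mathbf{D}$ is almost surely invertible. $\mathbf{E}$ is the ''hollow'' part of $\mathbf{A}$ (zero diagonal, off-diagonal entries equal to those of $\mathbf{A}$). *)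

(* Defs.v *)
From HB Require Import structures.
From mathcomp Require Import all_boot all_order all_algebra.
From mathcomp Require Import all_classical all_reals all_analysis.
From mathcomp Require Import complex.
Set Implicit Arguments. Unset Strict Implicit. Unset Printing Implicit Defensive.
Import Order.TTheory GRing.Theory Num.Theory.
Local Open Scope classical_set_scope.
Local Open Scope ring_scope.

(* Mutual independence of a finite family of real random variables:
   the product rule for every choice of Borel sets (taking setT for the
   unused indices gives the product rule for every subfamily). *)
Definition mutually_independent {R : realType} {d : measure_display}
  {T : measurableType d} (P : probability T R) {I : finType}
  (X : I -> {RV P >-> R}) : Prop :=
  forall A : I -> set R, (forall i, measurable (A i)) ->
    P (\bigcap_(i in [set: I]) (X i @^-1` A i)) = (\prod_(i : I) P (X i @^-1` A i))%E.

Definition Hmat {R : realType} {T : Type} (B U : nat)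
  (X : 'I_B * 'I_U * bool -> T -> R) (w : T) : 'M[R[i]]_(B, U) :=
  \matrix_(b, u) Complex (X (b, u, false) w) (X (b, u, true) w).

Definition ctrmx {R : rcfType} (m n : nat) (M : 'M[R[i]]_(m, n)) : 'M[R[i]]_(n, m) :=
  (map_mx (@conjc R) M)^T.

Definition Amat {R : rcfType} (B U : nat) (H : 'M[R[i]]_(B, U)) (N0 Es : R) : 'M[R[i]]_U :=
  ctrmx H *m H + ((N0 / Es)%:C)%C%:M.

Definition Dmat {R : rcfType} (U : nat) (A : 'M[R[i]]_U) : 'M[R[i]]_U :=
  diag_mx (\row_i A i i).
Definition Emat {R : rcfType} (U : nat) (A : 'M[R[i]]_U) : 'M[R[i]]_U :=
  A - Dmat A.

Definition frob {R : rcfType} (m n : nat) (M : 'M[R[i]]_(m, n)) : R :=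
  Num.sqrt (\sum_(i < m) \sum_(j < n) (let: Complex a b := M i j in a ^+ 2 + b ^+ 2)).

(* Main.v *)
Require Import Defs.
From HB Require Import structures.
From mathcomp Require Import all_boot all_order all_algebra.
From mathcomp Require Import all_classical all_reals all_analysis.
From mathcomp Require Import measurable_realfun complex ring lra.
Import Order.TTheory GRing.Theory Num.Theory.
Import numFieldNormedType.Exports HBNNSimple.
Local Open Scope classical_set_scope.
Local Open Scope ring_scope.

(** Write [a_ij] for the off-diagonal entries of [H^H H] and [S_i] for the
    squared norm of column [i]. Almost surely
    [||D^-1 E||_F^2 <= sum_(i != j) |a_ij|^2 / S_i^2], so by Markov's inequality
    it suffices to show [E(|a_ij|^2 / S_i^2) <= 1 / (B - 1)], which is below the
    square root of the statement.
    From [1 / S^2 = int_0^oo t exp(-t S) dt] and Tonelli, the expectation is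
    [int_0^oo t E(|a_ij|^2 exp(-t S_i)) dt]. Real and imaginary parts of [a_ij]
    are bilinear in the two columns, so expanding their squares gives products of
    functions of single coordinates: the cross terms vanish because the normal
    law is centered, and the diagonal ones are controlled by
    [E exp(-t x^2) = (1 + t)^(-1/2)] and [E(x^2 exp(-t x^2)) <= (1 + t)^(-3/2) / 2].
    This bounds the integrand by [B t (1 + t)^(-B-1)], whose integral is
    [1 / (B - 1)]. *)

(** * Integration against densities and products of independent variables *)

(** The hypothesis is the case of indicators. It extends to simple functions by linearity, then to
    [f] by monotone convergence on both sides. It serves twice: with [nu] the law of a random
    variable and [g] a product of other independent factors, and with [nu] a normal law and [g] its
    density. *)
Lemma ge0_integral_density {R : realType} d d' (T : measurableType d)
    (T' : measurableType d') (mu : {measure set T -> \bar R})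
    (nu : {measure set T' -> \bar R}) (X : T -> T') (g : T -> R) (c : R)
    (f : T' -> \bar R) :
  measurable_fun [set: T] X -> measurable_fun [set: T] g ->
  (forall x, 0 <= g x) -> 0 <= c ->
  measurable_fun [set: T'] f -> (forall y, (0 <= f y)%E) ->
  (forall A, measurable A ->
    \int[mu]_x ((g x)%:E * (\1_A (X x))%:E) = c%:E * nu A)%E ->
  (\int[mu]_x ((g x)%:E * f (X x)) = c%:E * \int[nu]_y f y)%E.
Proof.
move=> mX mg g0 c0 mf f0 gnu.
pose f_ := nnsfun_approx measurableT mf.
have f_cvg y : EFin \o f_^~ y @ \oo --> f y by exact: cvg_nnsfun_approx.
have mEg : measurable_fun [set: T] (EFin \o g) by exact/measurable_EFinP.
have mfX n : measurable_fun [set: T] (fun x => (f_ n (X x))%:E).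
  by apply/measurable_EFinP; exact: measurableT_comp.
have f_int n : (\int[mu]_x ((g x)%:E * (f_ n (X x))%:E) =
                \int[nu]_y (c%:E * (f_ n y)%:E))%E.
  have mfn : measurable_fun [set: T'] (EFin \o f_ n) by exact/measurable_EFinP.
  rewrite (@ge0_integralZl _ _ _ _ _ _ (EFin \o f_ n)) ?lee_fin//=.
  have mind r : measurable_fun [set: T] (fun x => (\1_(f_ n @^-1` [set r]) (X x) : R)%:E).
    by apply/measurable_EFinP; apply: measurableT_comp => //; exact: measurable_indic.
  transitivity (\int[mu]_x \sum_(r \in range (f_ n))
     (r%:E * ((g x)%:E * (\1_(f_ n @^-1` [set r]) (X x))%:E)))%E.
    apply: eq_integral => x _; rewrite fimfunE -fsumEFin// ge0_mule_fsumr; last first.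
      by move=> r; rewrite EFinM nnfun_muleindic_ge0.
    by apply: eq_fsbigr => r _; rewrite EFinM muleCA.
  rewrite ge0_integral_fsum//; last 2 first.
  - by move=> r; apply: emeasurable_funM => //; exact: emeasurable_funM.
  - move=> r x _.
    by rewrite muleCA mule_ge0 ?nnfun_muleindic_ge0// lee_fin.
  under [X in (_ * X)%E]eq_integral do rewrite fimfunE -fsumEFin//.
  rewrite ge0_integral_fsum//; last 2 first.
  - by move=> r; apply/measurable_EFinP; exact: measurable_funM.
  - by move=> r x _; rewrite EFinM nnfun_muleindic_ge0.
  rewrite ge0_mule_fsumr; last first.
    by move=> r; apply: integral_ge0 => x _; rewrite EFinM nnfun_muleindic_ge0.
  apply: eq_fsbigr => r /set_mem [y _ <-].
  rewrite ge0_integralZl//; last 3 first.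
  - exact: emeasurable_funM.
  - by move=> x _; rewrite mule_ge0// lee_fin.
  - by rewrite lee_fin.
  rewrite integralZl_indic_nnsfun// integral_indic// setIT gnu//.
  by rewrite muleCA.
  by move=> x _; rewrite lee_fin.
have -> : (c%:E * \int[nu]_y f y = \int[nu]_y (c%:E * f y))%E.
  by rewrite ge0_integralZl// lee_fin.
transitivity (limn (fun n => \int[mu]_x ((g x)%:E * (f_ n (X x))%:E)))%E.
  rewrite -monotone_convergence//.
  - apply: eq_integral => x _; apply/esym/cvg_lim => //.
    exact: (cvgeZl _ (f_cvg (X x))).
  - by move=> n; apply: emeasurable_funM; [exact: mEg|exact: mfX].
  - by move=> n x _; rewrite mule_ge0 ?lee_fin.
  - by move=> x _ m n mn; apply: lee_pmul; rewrite ?lee_fin//; exact/lefP/nd_nnsfun_approx.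
under eq_fun do rewrite f_int.
rewrite -monotone_convergence//.
- apply: eq_integral => y _; apply/cvg_lim => //.
  exact: (cvgeZl _ (f_cvg y)).
- by move=> n; apply: emeasurable_funM => //; exact/measurable_EFinP.
- by move=> n x _; rewrite mule_ge0 ?lee_fin.
- by move=> x _ m n mn; apply: lee_pmul; rewrite ?lee_fin//; exact/lefP/nd_nnsfun_approx.
Qed.

(** Induction on a list [s] of indices outside of which every factor is an indicator. For empty [s]
    this is the definition of independence. In the step, the induction hypothesis treats the product
    with factor [k] replaced by any indicator, and [ge0_integral_density] passes from indicators to
    [f k]. *)
Lemma ge0_integral_prod_independent {R : realType} d (T : measurableType d)
    (P : probability T R) (I : finType) (X : I -> {RV P >-> R})
    (f : I -> R -> R) :
  mutually_independent X ->
  (forall i, measurable_fun [set: R] (f i)) -> (forall i x, 0 <= f i x) ->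
  (forall i, P.-integrable [set: T] (fun w => (f i (X i w))%:E)) ->
  (\int[P]_w (\prod_i f i (X i w))%:E =
   (\prod_i \int[P]_w f i (X i w))%R%:E)%E.
Proof.
move=> indX.
suff H (s : seq I) : forall f : I -> R -> R,
    (forall i, measurable_fun [set: R] (f i)) -> (forall i x, 0 <= f i x) ->
    (forall i, P.-integrable [set: T] (fun w => (f i (X i w))%:E)) ->
    (forall i, i \notin s -> exists2 A, measurable A & f i = \1_A) ->
    (\int[P]_w (\prod_i f i (X i w))%:E =
     (\prod_i \int[P]_w f i (X i w))%R%:E)%E.
  move=> mf f0 fint; apply: (H (enum I)) => // i.
  by rewrite mem_enum.
elim: s {f} => [|k s IH] f mf f0 fint fs.
  have /choice[A fA] : forall i, exists A, measurable A /\ f i = \1_A.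
    by move=> i; have [//|A mA fiA] := fs i; exists A.
  pose E i := X i @^-1` A i.
  have mE i : measurable (E i).
    by rewrite -[E i]setTI; apply: measurable_funPT; [|exact: (fA i).1].
  have mEI : measurable (\bigcap_(i in [set: I]) E i).
    by apply: fin_bigcap_measurable.
  transitivity (\int[P]_w (\1_(\bigcap_(i in [set: I]) E i) w)%:E)%E.
    apply: eq_integral => w _; congr EFin.
    rewrite indicE; case: (boolP (w \in _)) => [/set_mem wE|].
      rewrite big1// => i _; rewrite (fA i).2 indicE mem_set//.
      exact: wE.
    move=> wE; have [i wEi] : exists i, ~ E i w.
      apply/existsNP => H; move/negP: wE; apply; apply/mem_set => i _; exact: H.
    by rewrite (bigD1 i)//= (fA i).2 indicE memNset// mul0r.
  rewrite integral_indic// setIT.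
  apply: (etrans (indX A (fun i => (fA i).1))).
  rewrite -prodEFin; apply: eq_bigr => i _.
  rewrite /Rintegral (_ : (fun w => (f i (X i w))%:E) = EFin \o \1_(E i)); last first.
    by apply/funext => w /=; rewrite (fA i).2.
  by rewrite integral_indic// setIT fineK// fin_num_measure.
pose g w := \prod_(j | j != k) f j (X j w).
pose c := \prod_(j | j != k) \int[P]_w f j (X j w).
have split_k h w : \prod_j (fun i => if i == k then h else f i) j (X j w) = g w * h (X k w).
  rewrite (bigD1 k)//= eqxx mulrC; congr (_ * _).
  by apply: eq_bigr => j /negPf ->.
transitivity (\int[P]_w ((g w)%:E * (f k (X k w))%:E))%E.
  by apply: eq_integral => w _; rewrite (bigD1 k)//= mulrC EFinM.
(* The weight [g] gathers the factors other than [k], and [c] is the product of their expectations;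
   the reference measure is the law of [X k]. *)
rewrite (@ge0_integral_density _ _ _ _ _ P (distribution P (X k)) (X k) g c (EFin \o f k))//.
- rewrite ge0_integral_distribution//; last 2 first.
    exact/measurable_EFinP.
    by move=> y; rewrite lee_fin.
  rewrite [in RHS](bigD1 k)//= mulrC EFinM /Rintegral fineK//.
  exact: integrable_fin_num (fint k).
- rewrite (_ : g = fun w => \prod_(j <- [seq j <- index_enum I | j != k]) f j (X j w)).
    by apply: measurable_prod => j _; exact: measurableT_comp.
  by apply/funext => w; rewrite big_filter.
- by move=> w; apply: prodr_ge0.
- by apply: prodr_ge0 => j _; apply: Rintegral_ge0.
- exact/measurable_EFinP.
- by move=> y; rewrite lee_fin.
move=> A mA.
have mXA : measurable (X k @^-1` A) by rewrite -[_ @^-1` _]setTI; exact: measurable_funPT.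
have /= := IH (fun i => if i == k then \1_A else f i).
under eq_integral do rewrite split_k EFinM.
move=> ->.
- rewrite (bigD1 k)//= eqxx mulrC EFinM; congr (_ * _)%E.
    by congr EFin; apply: eq_bigr => j /negPf ->.
  rewrite /Rintegral (_ : (fun w => (\1_A (X k w))%:E) = EFin \o \1_(X k @^-1` A))//.
  by rewrite integral_indic// setIT fineK// fin_num_measure.
- by move=> i; case: ifP => // _; exact: measurable_indic.
- by move=> i x; case: ifP.
- move=> i; case: eqP => [->|//].
  rewrite (_ : (fun w => (\1_A (X k w))%:E) = EFin \o \1_(X k @^-1` A))//.
  exact: integrable_indic.
- move=> i iNs; case: eqP => [_|/eqP ik]; first by exists A.
  by apply: fs; rewrite inE negb_or ik.
Qed.

(** Integrability follows from the nonnegative case applied to absolute values. For the equality,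
    the induction is on a list of indices outside of which the factors are nonnegative: factor [k]
    is split into positive and negative parts, and both sides are linear in it. *)
Lemma integral_prod_independent {R : realType} d (T : measurableType d)
    (P : probability T R) (I : finType) (X : I -> {RV P >-> R})
    (f : I -> R -> R) :
  mutually_independent X ->
  (forall i, measurable_fun [set: R] (f i)) ->
  (forall i, P.-integrable [set: T] (fun w => (f i (X i w))%:E)) ->
  P.-integrable [set: T] (fun w => (\prod_i f i (X i w))%:E) /\
  \int[P]_w (\prod_i f i (X i w)) = \prod_i \int[P]_w f i (X i w).
Proof.
move=> indX.
have int_prod (h : I -> R -> R) : (forall i, measurable_fun [set: R] (h i)) ->
    (forall i, P.-integrable [set: T] (fun w => (h i (X i w))%:E)) ->
    P.-integrable [set: T] (fun w => (\prod_i h i (X i w))%:E).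
  move=> mh hint; apply/integrableP; split.
    by apply/measurable_EFinP; apply: measurable_prod => j _; exact: measurableT_comp.
  have := @ge0_integral_prod_independent _ _ _ P _ X (fun i x => `|h i x|) indX.
  under eq_integral do rewrite /= -normr_prod.
  move=> ->; first exact: ltry.
  - by move=> i; exact: measurableT_comp.
  - by [].
  - by move=> i; exact: (integrable_abse (hint i)).
suff H (s : seq I) : forall f : I -> R -> R,
    (forall i, measurable_fun [set: R] (f i)) ->
    (forall i, P.-integrable [set: T] (fun w => (f i (X i w))%:E)) ->
    (forall i, i \notin s -> forall x, 0 <= f i x) ->
    \int[P]_w (\prod_i f i (X i w)) = \prod_i \int[P]_w f i (X i w).
  move=> mf fint; split; first exact: int_prod.
  by apply: (H (enum I)) => // i; rewrite mem_enum.
elim: s {f} => [|k s IH] f mf fint fs.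
  by rewrite {1}/Rintegral ge0_integral_prod_independent// => i x; exact: fs.
pose F h i := if i == k then h else f i.
pose pp (x : R) : R := Num.max (f k x) 0.
pose nn (x : R) : R := Num.max (- f k x) 0.
have mpp : measurable_fun [set: R] pp by exact: measurable_maxr.
have mnn : measurable_fun [set: R] nn.
  by apply: measurable_maxr => //; exact: measurableT_comp.
have fE x : f k x = pp x - nn x.
  rewrite /pp /nn; case: (leP 0 (f k x)) => fk.
    by rewrite max_r ?subr0// oppr_le0.
  by rewrite max_l ?opprK ?add0r// oppr_ge0 ltW.
have bnd (h : R -> R) : measurable_fun [set: R] h -> (forall x, `|h x| <= `|f k x|) ->
    P.-integrable [set: T] (fun w => (h (X k w))%:E).
  move=> mh hf; apply: (le_integrable _ _ _ (fint k)) => //.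
    by apply/measurable_EFinP; exact: measurableT_comp.
  by move=> w _; rewrite /= lee_fin.
have pint : P.-integrable [set: T] (fun w => (pp (X k w))%:E).
  apply: bnd => // x; rewrite /pp; case: (leP 0 (f k x)) => // _.
  by rewrite normr0.
have nint : P.-integrable [set: T] (fun w => (nn (X k w))%:E).
  apply: bnd => // x; rewrite /nn; case: (leP 0 (- f k x)) => // _.
    by rewrite normrN.
  by rewrite normr0.
have split_k h w : \prod_j F h j (X j w) = h (X k w) * \prod_(j | j != k) f j (X j w).
  rewrite (bigD1 k)//= /F eqxx; congr (_ * _).
  by apply: eq_bigr => j /negPf ->.
have mF (h : R -> R) : measurable_fun [set: R] h -> forall i, measurable_fun [set: R] (F h i).
  by move=> mh i; rewrite /F; case: ifP.
have Fint (h : R -> R) : P.-integrable [set: T] (fun w => (h (X k w))%:E) ->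
    forall i, P.-integrable [set: T] (fun w => (F h i (X i w))%:E).
  by move=> hint i; rewrite /F; case: eqP => [->|].
have F0 (h : R -> R) : (forall x, 0 <= h x) -> forall i, i \notin s -> forall x, 0 <= F h i x.
  move=> h0 i iNs; rewrite /F; case: eqP => [//|/eqP ik].
  by apply: fs; rewrite inE negb_or ik.
have IHh (h : R -> R) : measurable_fun [set: R] h -> (forall x, 0 <= h x) ->
    P.-integrable [set: T] (fun w => (h (X k w))%:E) ->
    \int[P]_w (\prod_i F h i (X i w)) =
    (\int[P]_w h (X k w)) * \prod_(j | j != k) \int[P]_w f j (X j w).
  move=> mh h0 hint; rewrite IH; [|exact: mF|exact: Fint|exact: F0].
  rewrite (bigD1 k)//= /F eqxx; congr (_ * _).
  by apply: eq_bigr => j /negPf ->.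
transitivity (\int[P]_w (\prod_i F pp i (X i w) - \prod_i F nn i (X i w))).
  apply: eq_Rintegral => w _.
  by rewrite !split_k -mulrBl -fE (bigD1 k).
rewrite RintegralB//; last 2 first.
- by apply: int_prod; [exact: mF|exact: Fint].
- by apply: int_prod; [exact: mF|exact: Fint].
rewrite !IHh//; last 2 first.
- by move=> x; rewrite le_max lexx orbT.
- by move=> x; rewrite le_max lexx orbT.
rewrite -mulrBl -RintegralB// [RHS](bigD1 k)//=; congr (_ * _).
by apply: eq_Rintegral => w _; rewrite fE.
Qed.

(** * Gaussian integrals for the centered normal law of variance 1/2 *)

Lemma ge0_integral_normal_prob {R : realType} (m s : R) (f : R -> \bar R) :
  measurable_fun [set: R] f -> (forall x, (0 <= f x)%E) ->
  (\int[normal_prob m s]_x f x =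
   \int[lebesgue_measure]_x ((normal_pdf m s x)%:E * f x))%E.
Proof.
move=> mf f0.
rewrite (@ge0_integral_density _ _ _ _ _ lebesgue_measure (normal_prob m s)
  (fun x => x) (normal_pdf m s) 1 f)//.
- by rewrite mul1e.
- exact: measurable_normal_pdf.
- by move=> x; exact: normal_pdf_ge0.
move=> A mA; rewrite mul1e /normal_prob [RHS]integral_mkcond; apply: eq_integral => x _.
by rewrite epatch_indic.
Qed.

(** Completing the exponent, the density times [exp(-t x^2)] is [1 / s] times the centered normal
    density of standard deviation [sqrt(1/2) / s], with [s = sqrt(1 + t)]. Negative [t] is allowed
    because the next lemma compares [t] with smaller values, down to -1. *)
Lemma integral_normal_expR {R : realType} (t : R) : -1 < t ->
  (\int[normal_prob 0 (Num.sqrt 2^-1)]_x (expR (- (t * x ^+ 2)))%:E =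
   ((Num.sqrt (1 + t))^-1)%:E)%E.
Proof.
move=> t1; have s0 : 0 < Num.sqrt (1 + t) by rewrite sqrtr_gt0; lra.
set s := Num.sqrt (1 + t) in s0 *.
have s2 : s ^+ 2 = 1 + t by rewrite sqr_sqrtr//; lra.
have h0 : 0 < Num.sqrt (2^-1 : R) by rewrite sqrtr_gt0.
have h2 : Num.sqrt (2^-1 : R) ^+ 2 = 2^-1 by rewrite sqr_sqrtr.
have mexp : measurable_fun [set: R] (fun x : R => expR (- (t * x ^+ 2))).
  apply: measurableT_comp => //; apply: measurableT_comp => //.
  by apply: measurable_funM => //; exact: exprn_measurable.
rewrite ge0_integral_normal_prob; last 2 first.
- exact/measurable_EFinP.
- by move=> x; rewrite lee_fin expR_ge0.
transitivity (\int[lebesgue_measure]_x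
    ((s^-1)%:E * (normal_pdf 0 (Num.sqrt 2^-1 / s) x)%:E))%E; last first.
  rewrite ge0_integralZl//.
  - by rewrite integral_normal_pdf mule1.
  - by apply/measurable_EFinP; exact: measurable_normal_pdf.
  - by move=> x _; rewrite lee_fin normal_pdf_ge0.
  - by rewrite lee_fin invr_ge0 ltW.
apply: eq_integral => x _; rewrite -!EFinM; congr EFin.
rewrite !normal_pdfE ?gt_eqF ?divr_gt0// /normal_peak /normal_fun !subr0.
rewrite exprMn exprVn h2 s2 -mulrA -expRD.
have -> : - x ^+ 2 / (2^-1 *+ 2) - t * x ^+ 2 = - x ^+ 2 / (2^-1 / (1 + t) *+ 2).
  by field; lra.
rewrite mulrA; congr (_ * _).
have -> : 2^-1 / (1 + t) * pi *+ 2 = (s^-1) ^+ 2 * (2^-1 * pi *+ 2).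
  by rewrite exprVn s2; field; lra.
rewrite [in RHS]sqrtrM ?sqr_ge0// sqrtr_sqr gtr0_norm ?invr_gt0//.
by rewrite invfM invrK mulrA mulVf ?mul1r// gt_eqF.
Qed.

(** The bound is minus the derivative of [(1 + t)^(-1/2)]. As only an upper bound is wanted,
    difference quotients suffice and no differentiation under the integral sign is made. *)
Lemma integral_normal_sqr_expR_le {R : realType} (t : R) : 0 <= t ->
  (\int[normal_prob 0 (Num.sqrt 2^-1)]_x (x ^+ 2 * expR (- (t * x ^+ 2)))%:E <=
   ((2 * Num.sqrt (1 + t) ^+ 3)^-1)%:E)%E.
Proof.
move=> t0; have s0 : 0 < Num.sqrt (1 + t) by rewrite sqrtr_gt0; lra.
have s2 : Num.sqrt (1 + t) ^+ 2 = 1 + t by rewrite sqr_sqrtr//; lra.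
have mexpR u : measurable_fun [set: R] (fun x : R => expR (- (u * x ^+ 2))).
  apply: measurableT_comp => //; apply: measurableT_comp => //.
  by apply: measurable_funM => //; exact: exprn_measurable.
have msqr : measurable_fun [set: R] (fun x : R => (x ^+ 2 * expR (- (t * x ^+ 2)))%:E).
  apply/measurable_EFinP; apply: measurable_funM; first exact: exprn_measurable.
  exact: mexpR.
have mexp u : measurable_fun [set: R] (fun x : R => (expR (- (u * x ^+ 2)))%:E).
  exact/measurable_EFinP.
set M := (\int[_]_x _)%E.
have M0 : (0 <= M)%E.
  by apply: integral_ge0 => x _; rewrite lee_fin mulr_ge0 ?sqr_ge0 ?expR_ge0.
set s := Num.sqrt (1 + t) in s0 s2 *.
(* Convexity of exp: [h x^2 e^(-t x^2) + e^(-t x^2) <= e^(-(t-h) x^2)], with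
   [h = s^2 - r^2]; the claim follows by letting [r] tend to [s]. *)
have diff r : 0 < r -> r < s -> ((s ^+ 2 - r ^+ 2)%:E * M + (s^-1)%:E <= (r^-1)%:E)%E.
  move=> r0 rs.
  have h0 : 0 <= s ^+ 2 - r ^+ 2 by rewrite subr_ge0 lerXn2r// ?nnegrE ltW.
  have r2 : 0 < r ^+ 2 by rewrite exprn_gt0.
  have -> : s^-1 = (Num.sqrt (1 + t))^-1 by [].
  have -> : r^-1 = (Num.sqrt (1 + (t - (s ^+ 2 - r ^+ 2))))^-1.
    rewrite (_ : 1 + _ = r ^+ 2) ?sqrtr_sqr ?gtr0_norm//.
    by rewrite s2; ring.
  have t1 : -1 < t by lra.
  have t2 : -1 < t - (s ^+ 2 - r ^+ 2) by lra.
  rewrite -(integral_normal_expR _ t1) -(integral_normal_expR _ t2).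
  have sq0 x : True -> (0 <= (x ^+ 2 * expR (- (t * x ^+ 2)))%:E)%E.
    by move=> _; rewrite lee_fin mulr_ge0 ?sqr_ge0 ?expR_ge0.
  have -> : ((s ^+ 2 - r ^+ 2)%:E * M = \int[normal_prob 0 (Num.sqrt 2^-1)]_x
      ((s ^+ 2 - r ^+ 2)%:E * (x ^+ 2 * expR (- (t * x ^+ 2)))%:E))%E.
    by rewrite ge0_integralZl// lee_fin.
  rewrite -ge0_integralD//.
  2: by move=> x _; apply: mule_ge0; [rewrite lee_fin|exact: sq0].
  2: by apply: emeasurable_funM => //; exact: msqr.
  2: exact: mexp.
  apply: ge0_le_integral => //.
  - move=> x _; apply: adde_ge0; last by rewrite lee_fin expR_ge0.
    by apply: mule_ge0; [rewrite lee_fin|exact: sq0].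
  - by apply: emeasurable_funD; [apply: emeasurable_funM => //; exact: msqr|exact: mexp].
  - exact: mexp.
  move=> x _; rewrite -EFinM -EFinD lee_fin.
  have -> : - ((t - (s ^+ 2 - r ^+ 2)) * x ^+ 2) =
      (s ^+ 2 - r ^+ 2) * x ^+ 2 + - (t * x ^+ 2) by ring.
  rewrite expRD mulrA -{2}[expR (- (t * x ^+ 2))]mul1r -mulrDl ler_pM2r ?expR_gt0//.
  by rewrite addrC expR_ge1Dx.
(* At [r = s / 2] the coefficient of [M] in [diff] is positive, so an infinite [M] would contradict
   the finite right-hand side. *)
have Mfin : M \is a fin_num.
  rewrite ge0_fin_numE//; case E : M M0 => [m| |]//= _; first exact: ltry.
  have := diff (s / 2); rewrite E divr_gt0// => /(_ erefl) H.
  have h0 : 0 < s ^+ 2 - (s / 2) ^+ 2.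
    rewrite (_ : _ - _ = s ^+ 2 * (3 / 4)); last by field.
    by rewrite mulr_gt0 ?exprn_gt0.
  move: H; rewrite gt0_muley ?lte_fin//= => H.
  by have /H : s / 2 < s by lra.
rewrite -(fineK Mfin) lee_fin.
have m0 : 0 <= fine M by rewrite fine_ge0.
move: diff; rewrite -(fineK Mfin); set m := fine M in m0 * => diff.
have s3 : 0 < 2 * s ^+ 3 by rewrite mulr_gt0 ?exprn_gt0.
rewrite -[leRHS]mul1r ler_pdivlMr//.
set C := s ^+ 3 * m; have C0 : 0 <= C by rewrite mulr_ge0// exprn_ge0 ?ltW.
(* The goal is [2 C <= 1]. With [r = s (1 - e)], multiplying [diff] by [r] and dividing by [e] gives
   [(2 - e) (1 - e) C <= 1], and [(2 - e) (1 - e) >= 2 - 3 e]. *)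
have bnd e : 0 < e -> e < 1 -> 2 * C - 3 * e * C <= 1.
  move=> e0 e1; have r0 : 0 < s * (1 - e) by rewrite mulr_gt0 ?subr_gt0.
  have := diff (s * (1 - e)) r0; rewrite -EFinM -EFinD lee_fin.
  have -> : s * (1 - e) < s by rewrite gtr_pMr//; lra.
  move=> /(_ erefl) H.
  have se : s * (1 - e) != 0 by rewrite gt_eqF.
  have : ((s ^+ 2 - (s * (1 - e)) ^+ 2) * m + s^-1) * (s * (1 - e)) <= 1.
    by rewrite -ler_pdivlMr// mul1r.
  rewrite (_ : _ * (s * (1 - e)) = (2 - e) * e * (1 - e) * C + (1 - e)); last first.
    by rewrite /C; field; rewrite gt_eqF.
  move=> {}H.
  have {}H : e * ((2 - e) * (1 - e) * C) <= e * 1 by lra.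
  rewrite ler_pM2l// in H; nra.
rewrite (_ : m * _ = 2 * C); last by rewrite /C; ring.
rewrite leNgt; apply/negP => C1.
have D0 : 0 < 3 * C by lra.
(* The second term forces [3 e C <= (2 C - 1) / 2], so the left side of [bnd] is at least
   [C + 1/2 > 1]; the first keeps [e < 1]. *)
pose e := Num.min (1 / 2) ((2 * C - 1) / (6 * C)).
have e0 : 0 < e by rewrite lt_min; apply/andP; split; [lra|rewrite divr_gt0; lra].
have e1 : e < 1 by rewrite gt_min; apply/orP; left; lra.
have e2 : e * (6 * C) <= 2 * C - 1.
  by rewrite -ler_pdivlMr ?ge_min ?lexx ?orbT//; lra.
have := bnd e e0 e1; nra.
Qed.

(** Lebesgue measure and the centered density are both invariant under [x -> -x]. *)
Lemma normal_prob_oppr {R : realType} (s : R) (A : set R) : s != 0 -> measurable A ->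
  normal_prob 0 s (-%R @^-1` A) = normal_prob 0 s A.
Proof.
move=> s0 mA; rewrite /normal_prob.
transitivity (\int[pushforward lebesgue_measure (-%R : R -> measurableTypeR R)]_(x in A)
    (normal_pdf 0 s x)%:E)%E; last first.
  apply: eq_measure_integral => B mB _; exact: lebesgue_measureN.
rewrite ge0_integral_pushforward//.
- apply: eq_integral => x _; rewrite /= !normal_pdfE// /normal_fun !subr0.
  by rewrite sqrrN.
- by apply/measurable_EFinP; apply: measurable_funTS; exact: measurable_normal_pdf.
- by move=> x _; rewrite lee_fin normal_pdf_ge0.
Qed.

(** By symmetry the integral equals its own opposite; integrability makes it finite, hence zero. *)
Lemma integral_normal_id {R : realType} (s : R) : s != 0 ->
  (normal_prob 0 s).-integrable [set: R] EFin ->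
  (\int[normal_prob 0 s]_x x%:E = 0)%E.
Proof.
move=> s0 int_id.
have : (\int[normal_prob 0 s]_x x%:E = \int[normal_prob 0 s]_x (- x)%:E)%E.
  transitivity (\int[pushforward (normal_prob 0 s) (-%R : R -> measurableTypeR R)]_x x%:E)%E.
    apply: eq_measure_integral => A mA _; exact/esym/normal_prob_oppr.
  rewrite integral_pushforward//.
  exact: (integrableN int_id).
under [in RHS]eq_integral do rewrite EFinN.
rewrite integralN; last exact: integrable_add_def.
have := integrable_fin_num measurableT int_id.
case: (\int[_]_x _)%E => // r _ [] rr; congr EFin; lra.
Qed.

(** * Two improper integrals over the half-line *)

Lemma cvgy0_le_inv {R : realType} (F : R -> R) (C : R) :
  (forall t, 0 < t -> `|F t| <= C / t) -> F t @[t --> +oo] --> 0.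
Proof.
move=> FC; apply/cvgrPdist_le => e e0; near=> t.
have t0 : 0 < t by near: t; apply: nbhs_pinfty_gt; exact: num_real.
rewrite sub0r normrN (le_trans (FC _ t0))// ler_pdivrMr// mulrC -ler_pdivrMr//.
Unshelve. all: by end_near. Qed.

Lemma integral_id_expR {R : realType} (s : R) : 0 < s ->
  (\int[lebesgue_measure]_(t in `[0%R, +oo[) (t * expR (- (t * s)))%:E =
   ((s ^+ 2)^-1)%:E)%E.
Proof.
move=> s0; have sN0 : s != 0 by rewrite gt_eqF.
(* A primitive of the integrand that tends to 0 at infinity, with [F 0 = - 1 / s^2]. *)
pose F (t : R) : R := - ((t / s + (s ^+ 2)^-1) * expR (- (t * s))).
have dF (t : R) : is_derive t 1 F (t * expR (- (t * s))).
  rewrite /F; apply: is_derive_eq.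
  by rewrite /GRing.scale /=; field.
have cF : continuous F.
  by move=> t; apply/differentiable_continuous/derivable1_diffP; case: (dF t).
rewrite (@ge0_continuous_FTC2y _ _ F 0 0).
- by rewrite /F !mul0r add0r oppr0 expR0 mulr1 ?sub0e -?EFinN ?opprK ?add0r.
- by move=> t t0; rewrite mulr_ge0 ?expR_ge0.
- apply: continuous_subspaceT => t; apply: cvgM; first exact: cvg_id.
  apply: (cvg_comp _ expR); last exact: continuous_expR.
  by apply: cvgN; apply: cvgM; [exact: cvg_id|exact: cvg_cst].
- apply: (@cvgy0_le_inv _ _ (4 / s ^+ 3)) => t t0.
  have x0 : 0 < t * s by rewrite mulr_gt0.
  rewrite normrN ger0_norm; last first.
    by rewrite mulr_ge0 ?expR_ge0// addr_ge0 ?invr_ge0 ?divr_ge0 ?exprn_ge0 ?ltW.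
  have -> : t / s + (s ^+ 2)^-1 = (s ^+ 2)^-1 * (1 + t * s) by field.
  rewrite expRN ler_pdivrMr ?expR_gt0//.
  (* The polynomial in [F] is linear in [t] and the target is of order [1 / t], so [exp] needs a
     quadratic lower bound: [exp(x / 2) >= 1 + x / 2] is squared. *)
  have e2 : (1 + t * s / 2) ^+ 2 <= expR (t * s).
    rewrite (_ : t * s = t * s / 2 + t * s / 2); last by field.
    rewrite expRD -expr2 -(_ : t * s = t * s / 2 + t * s / 2); last by field.
    by rewrite lerXn2r ?nnegrE ?expR_ge0 ?expR_ge1Dx//; lra.
  apply: (@le_trans _ _ (4 / s ^+ 3 / t * (1 + t * s / 2) ^+ 2)); last first.
    by rewrite ler_wpM2l// !divr_ge0 ?exprn_ge0// ltW.
  rewrite -subr_ge0 (_ : _ - _ = (s ^+ 2)^-1 * ((4 + 3 * (t * s)) / (t * s))); last first.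
    by field; rewrite sN0 gt_eqF.
  by rewrite mulr_ge0 ?divr_ge0 ?invr_ge0 ?exprn_ge0 ?ltW//; lra.
- by move=> t _; case: (dF t).
- by apply: cvg_at_right_filter; exact: cF.
- by move=> t _; rewrite derive1E derive_val.
Qed.

Lemma integral_id_expV {R : realType} (n : nat) : (0 < n)%N ->
  (\int[lebesgue_measure]_(t in `[0%R, +oo[) (t * (1 + t) ^- n.+2)%:E =
   ((n%:R * n.+1%:R)^-1 : R)%:E)%E.
Proof.
move=> n0; have nN0 : n%:R != 0 :> R by rewrite pnatr_eq0 -lt0n.
pose u (t : R) : R := (1 + t)^-1.
(* The primitive given by integration by parts. It tends to 0 at infinity because
   [u t ^+ n <= 1 / t] for [n > 0], and [F 0 = - 1 / (n (n + 1))]. *)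
pose F : R -> R :=
  - (id * u ^+ n.+1 * cst n.+1%:R^-1 + u ^+ n * cst (n%:R * n.+1%:R)^-1).
have FE t : F t = - (t * u t ^+ n.+1 / n.+1%:R + u t ^+ n / (n%:R * n.+1%:R)).
  by rewrite /F !fctE.
have dF (t : R) : 0 <= t -> is_derive t 1 F (t * (1 + t) ^- n.+2).
  move=> t0; have t1 : 1 + t != 0 by rewrite gt_eqF//; lra.
  have dV : is_derive t 1 u (- (1 + t) ^- 2).
    rewrite /u; apply: is_derive_eq.
    by rewrite add0r /GRing.scale /= mulr1.
  rewrite /F; apply: is_derive_eq.
  rewrite !fctE /GRing.scale /=.
  have -> : u t ^+ n = (1 + t) * u t ^+ n.+1 by rewrite exprS mulrA divff// mul1r.
  have -> : u t ^+ n.-1 = (1 + t) ^+ 2 * u t ^+ n.+1.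
    by rewrite -{2}(prednK n0) !exprS /u; field.
  have pN0 : (1 + t) ^+ n != 0 by rewrite expf_neq0.
  have n1 : n%:R + 1 != 0 :> R by rewrite natr1 pnatr_eq0.
  by rewrite !exprS expr0 /u exprVn -natr1; field; rewrite t1 pN0 nN0 n1.
rewrite (@ge0_continuous_FTC2y _ _ F 0 0).
- by rewrite FE !mul0r add0r /u addr0 invr1 expr1n mul1r ?sub0e -?EFinN ?opprK ?add0r.
- by move=> t t0; rewrite mulr_ge0 ?invr_ge0 ?exprn_ge0//; lra.
- apply: continuous_in_subspaceT => t; rewrite inE/= in_itv/= andbT => t0.
  apply: cvgM; first exact: cvg_id.
  apply: cvgV; first by rewrite expf_neq0// gt_eqF//; lra.
  apply: (cvg_comp (fun t : R => 1 + t) (fun x => x ^+ n.+2)); last exact: exprn_continuous.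
  by apply: cvgD; [exact: cvg_cst|exact: cvg_id].
- apply: (@cvgy0_le_inv _ _ (n.+1%:R^-1 + (n%:R * n.+1%:R)^-1)) => t t0.
  rewrite FE /u.
  have t1 : 0 < 1 + t by lra.
  have u0 : 0 <= (1 + t)^-1 by rewrite invr_ge0 ltW.
  have un : (1 + t)^-1 ^+ n <= t^-1.
    rewrite -(prednK n0) exprS (@le_trans _ _ ((1 + t)^-1))//.
      by rewrite ler_piMr// exprn_ile1// invf_le1//; lra.
    by rewrite lef_pV2 ?posrE//; lra.
  rewrite normrN ger0_norm; last first.
    by rewrite addr_ge0 ?divr_ge0 ?mulr_ge0 ?exprn_ge0// ltW.
  rewrite mulrDl; apply: lerD; rewrite mulrC ler_wpM2l//.
  rewrite exprS mulrA (le_trans _ un)// ler_piMl ?exprn_ge0//.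
  by rewrite ler_pdivrMr//; lra.
- by move=> t /ltW t0; case: (dF t t0).
- apply: cvg_at_right_filter; apply/differentiable_continuous/derivable1_diffP.
  by case: (dF 0 (lexx _)).
- move=> t; rewrite in_itv/= andbT => /ltW t0; have ? := dF t t0.
  by rewrite derive1E derive_val.
Qed.

(** * Expectations of functions of one normal variable *)

(** The second parameter of [normal_prob] is a standard deviation: the variance is 1/2, that of the
    real or imaginary part of a circular complex Gaussian of unit variance. *)
Definition has_law_N0half {R : realType} d (T : measurableType d)
    (P : probability T R) (Y : {RV P >-> R}) :=
  forall A : set R, measurable A ->
    distribution P Y A = normal_prob 0 (Num.sqrt 2^-1) A.

Section normal_random_variable.
Context {R : realType} d (T : measurableType d) (P : probability T R).
Variable Y : {RV P >-> R}.
Hypothesis hY : has_law_N0half _ _ _ Y.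

Let mY : measurable_fun [set: T] (Y : T -> measurableTypeR R).
Proof. exact: (measurable_funPT Y). Qed.

Lemma ge0_integral_N0half (f : R -> R) : measurable_fun [set: R] f ->
  (forall x, 0 <= f x) ->
  (\int[P]_w (f (Y w))%:E =
   \int[normal_prob 0 (Num.sqrt 2^-1)]_x (f x)%:E)%E.
Proof.
move=> mf f0.
transitivity (\int[pushforward P (Y : T -> measurableTypeR R)]_x (f x)%:E)%E.
  rewrite ge0_integral_pushforward//; first exact/measurable_EFinP.
  by move=> x _; rewrite lee_fin.
by apply: eq_measure_integral => A mA _; exact: hY.
Qed.

Let mexpR (t : R) : measurable_fun [set: R] (fun x : R => expR (- (t * x ^+ 2))).
Proof.
apply: measurableT_comp => //; apply: measurableT_comp => //.
by apply: measurable_funM => //; exact: exprn_measurable.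
Qed.

Lemma Rintegral_expR_N0half (t : R) : -1 < t ->
  \int[P]_w expR (- (t * Y w ^+ 2)) = (Num.sqrt (1 + t))^-1.
Proof.
move=> t1; rewrite /Rintegral (ge0_integral_N0half (fun x => expR (- (t * x ^+ 2))))//.
  by rewrite integral_normal_expR.
Qed.

Let sqr_expR_le (t : R) : 0 <= t ->
  (\int[P]_w (Y w ^+ 2 * expR (- (t * Y w ^+ 2)))%:E <=
   ((2 * Num.sqrt (1 + t) ^+ 3)^-1)%:E)%E.
Proof.
move=> t0; rewrite (ge0_integral_N0half (fun x => x ^+ 2 * expR (- (t * x ^+ 2)))).
- exact: integral_normal_sqr_expR_le.
- by apply: measurable_funM; [exact: exprn_measurable|exact: mexpR].
- by move=> x; rewrite mulr_ge0 ?sqr_ge0 ?expR_ge0.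
Qed.

Lemma Rintegral_sqr_expR_N0half_le (t : R) : 0 <= t ->
  \int[P]_w (Y w ^+ 2 * expR (- (t * Y w ^+ 2))) <=
  (2 * Num.sqrt (1 + t) ^+ 3)^-1.
Proof.
move=> /sqr_expR_le H; rewrite /Rintegral.
rewrite -lee_fin fineK// ge0_fin_numE; first exact: le_lt_trans H (ltry _).
by apply: integral_ge0 => w _; rewrite lee_fin mulr_ge0 ?sqr_ge0 ?expR_ge0.
Qed.

Let msqr : measurable_fun [set: T] (fun w => Y w ^+ 2).
Proof. by apply: measurable_funX. Qed.

(** The second moment is finite by the case [t = 0] of [sqr_expR_le]. The dominating function
    [1 + x^2] covers [1], [x] and [x^2], with or without the factor [exp(-t x^2)]. *)
Lemma integrable_N0half (f : R -> R) : measurable_fun [set: R] f ->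
  (forall x, `|f x| <= 1 + x ^+ 2) ->
  P.-integrable [set: T] (fun w => (f (Y w))%:E).
Proof.
move=> mf fx.
have i2 : P.-integrable [set: T] (fun w => (Y w ^+ 2)%:E).
  apply/integrableP; split; first exact/measurable_EFinP.
  apply: le_lt_trans (ltry (2 * Num.sqrt (1 + 0 : R) ^+ 3)^-1).
  apply: le_trans (sqr_expR_le 0 (lexx _)).
  rewrite le_eqVlt; apply/orP; left; apply/eqP/eq_integral => w _.
  by rewrite mul0r oppr0 expR0 mulr1 /= ger0_norm ?sqr_ge0.
have i1 : P.-integrable [set: T] (fun w => (1 : R)%:E).
  exact: finite_measure_integrable_cst.
apply: (le_integrable _ _ _ (integrableD _ i1 i2)) => //.
  by apply/measurable_EFinP; exact: measurableT_comp.
move=> w _; rewrite /= lee_fin (le_trans (fx _))//.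
by rewrite ler_norm.
Qed.

Lemma Rintegral_N0half : \int[P]_w Y w = 0.
Proof.
have iY : P.-integrable [set: T] (fun w => (Y w)%:E).
  apply: (integrable_N0half id) => // x; rewrite ler_norml; apply/andP; split; nra.
have h0 : Num.sqrt 2^-1 != 0 :> R by rewrite gt_eqF// sqrtr_gt0.
rewrite /Rintegral (_ : (\int[P]_w _)%E = 0%E)//.
rewrite -(integral_normal_id (Num.sqrt 2^-1) h0).
  transitivity (\int[pushforward P (Y : T -> measurableTypeR R)]_x x%:E)%E.
    rewrite integral_pushforward//.
  by apply: eq_measure_integral => A mA _; exact: hY.
apply/integrableP; split => //.
rewrite -(@ge0_integral_N0half (fun x => `|x|))//.
by have /integrableP[_] := iY.
Qed.

End normal_random_variable.

(** * Bilinear forms in two independent Gaussian vectors *)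

Section quadratic_form.
Context {R : realType} d (T : measurableType d) (P : probability T R).
Variables (J : finType) (Y : J * bool -> {RV P >-> R}) (eps : J -> R).
Hypothesis indY : mutually_independent Y.
Hypothesis hY : forall m, has_law_N0half _ _ _ (Y m).
Hypothesis eps1 : forall j, eps j ^+ 2 = 1.

(** The flag [false] marks the coordinates of the vector in the exponential, [true] those of the
    other; the signs [eps] let one statement serve real and imaginary parts. Each of the [#|J|]
    diagonal terms is at most [1/2] times [1 / (2 s^3)] times [#|J| - 1] factors [1 / s], whence the
    factor [1/4] and the exponent [#|J| + 2]. *)
Lemma integral_sqr_bilinear_expR_le (t : R) : 0 <= t ->
  (\int[P]_w ((\sum_j eps j * Y (j, false) w * Y (j, true) w) ^+ 2 *
     expR (- (t * \sum_j Y (j, false) w ^+ 2)))%:E <=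
   (#|J|%:R / 4 * (Num.sqrt (1 + t))^-1 ^+ #|J|.+2)%:E)%E.
Proof.
move=> t0; set s := Num.sqrt (1 + t).
have s0 : 0 < s by rewrite sqrtr_gt0; lra.
(* The factor at coordinate [m] of the term [(j, k)] of the expanded square. The exponent counts how
   often [m.1] occurs among [j] and [k], so it is 2 when all three coincide. *)
pose f (j k : J) (m : J * bool) (x : R) : R :=
  x ^+ ((m.1 == j) + (m.1 == k)) * (if m.2 then 1 else expR (- (t * x ^+ 2))).
have mf j k m : measurable_fun [set: R] (f j k m).
  apply: measurable_funM; first exact: exprn_measurable.
  case: m.2 => //; apply: measurableT_comp => //; apply: measurableT_comp => //.
  by apply: measurable_funM => //; exact: exprn_measurable.
have fint j k m : P.-integrable [set: T] (fun w => (f j k m (Y m w))%:E).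
  apply: (@integrable_N0half _ _ _ _ _ (hY m) (f j k m) (mf j k m)) => x.
  rewrite /f normrM.
  have e1 : `|if m.2 then 1 else expR (- (t * x ^+ 2))| <= 1.
    case: m.2; first by rewrite normr1.
    by rewrite ger0_norm ?expR_ge0// -expR0 ler_expR oppr_le0 mulr_ge0 ?sqr_ge0.
  apply: (@le_trans _ _ `|x ^+ ((m.1 == j) + (m.1 == k))|).
    by rewrite ler_piMr.
  have x1 : `|x| <= 1 + x ^+ 2 by rewrite ler_norml; apply/andP; split; nra.
  have x2 : `|x ^+ 2| <= 1 + x ^+ 2 by rewrite ger0_norm ?sqr_ge0// lerDr.
  by case: (m.1 == j); case: (m.1 == k) => //=; rewrite ?expr1// expr0 normr1 lerDl sqr_ge0.
have prodE j k w : \prod_m f j k m (Y m w) =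
    Y (j, false) w * Y (j, true) w * (Y (k, false) w * Y (k, true) w) *
    expR (- (t * \sum_j Y (j, false) w ^+ 2)).
  have sel (i : J) (y : J -> R) : \prod_l y l ^+ (l == i) = y i.
    by rewrite (bigD1 i)//= eqxx expr1 big1 ?mulr1// => l /negPf ->; rewrite expr0.
  rewrite (eq_bigr (fun m => (fun l b => f j k (l, b) (Y (l, b) w)) m.1 m.2)); last first.
    by move=> [l b].
  rewrite -(pair_bigA _ (fun l b => f j k (l, b) (Y (l, b) w)))/=.
  under eq_bigr do rewrite big_bool /f /= mulr1 !exprD.
  rewrite !big_split/= !sel mulr_sumr -sumrN expR_sum.
  ring.
have HE (w : T) : (\sum_j eps j * Y (j, false) w * Y (j, true) w) ^+ 2 *
     expR (- (t * \sum_j Y (j, false) w ^+ 2)) =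
    \sum_(p : J * J) eps p.1 * eps p.2 * \prod_m f p.1 p.2 m (Y m w).
  rewrite expr2 mulr_suml mulr_suml.
  rewrite -(pair_bigA _ (fun j k => eps j * eps k * \prod_m f j k m (Y m w)))/=.
  apply: eq_bigr => j _; rewrite mulr_sumr mulr_suml; apply: eq_bigr => k _.
  by rewrite prodE; ring.
have prod_int j k := @integral_prod_independent _ _ _ P _ Y (f j k) indY (mf j k) (fint j k).
under eq_integral do rewrite HE -sumEFin.
rewrite integral_sum//; last first.
  by move=> p; apply: (integrableZl _ _ (prod_int p.1 p.2).1).
have termE (p : J * J) : (\int[P]_w (eps p.1 * eps p.2 * \prod_m f p.1 p.2 m (Y m w))%:E =
    (eps p.1 * eps p.2 * \prod_m \int[P]_w f p.1 p.2 m (Y m w))%:E)%E.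
  under eq_integral do rewrite EFinM.
  rewrite integralZl//; last exact: (prod_int p.1 p.2).1.
  rewrite [RHS]EFinM -(prod_int p.1 p.2).2 /Rintegral fineK//.
  exact: integrable_fin_num (prod_int p.1 p.2).1.
under eq_bigr do rewrite termE.
rewrite sumEFin lee_fin.
rewrite -(pair_bigA _ (fun j k => eps j * eps k * \prod_m \int[P]_w f j k m (Y m w)))/=.
set q := _^-1 ^+ _.
have -> : #|J|%:R / 4 * q = \sum_(j : J) q / 4.
  by rewrite sumr_const -mulr_natl; ring.
apply: ler_sum => j _.
(* Only [k = j] survives: otherwise the coordinate [(k, true)] occurs to the first power, and it is
   centered. *)
rewrite (bigD1 j)//= [X in _ + X]big1 ?addr0; last first.
  move=> k kj; have int0 : \int[P]_w f j k (k, true) (Y (k, true) w) = 0.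
    rewrite -[RHS](@Rintegral_N0half _ _ _ _ _ (hY (k, true))).
    apply: eq_Rintegral => w _.
    by rewrite /f /= (negPf kj) eqxx expr1 mulr1.
  by rewrite (bigD1 (k, true))//= int0 mul0r mulr0.
rewrite -expr2 eps1 mul1r.
rewrite (eq_bigr (fun m => (fun l b => \int[P]_w f j j (l, b) (Y (l, b) w)) m.1 m.2)); last first.
  by move=> [l b].
rewrite -(pair_bigA _ (fun l b => \int[P]_w f j j (l, b) (Y (l, b) w)))/=.
rewrite (bigD1 j)//= [X in _ * X](eq_bigr (fun _ => s^-1)); last first.
  move=> l /negPf lj; rewrite big_bool /f /= lj.
  under eq_Rintegral do rewrite expr0 mulr1.
  under [X in _ * X]eq_Rintegral do rewrite expr0 mul1r.
  rewrite Rintegral_cst// (_ : fine _ = 1) ?mulr1 ?mul1r; last first.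
    by rewrite [X in fine X](@probability_setT _ _ _ P).
  by rewrite (@Rintegral_expR_N0half _ _ _ _ _ (hY _))//; lra.
rewrite prodr_const cardC1 big_bool /f /= eqxx.
(* The variance bound is the case [t = 0] of the weighted one. *)
have V : \int[P]_w (Y (j, true) w ^+ 2 * 1) <= 2^-1.
  have := @Rintegral_sqr_expR_N0half_le _ _ _ _ _ (hY (j, true)) 0 (lexx _).
  rewrite addr0 sqrtr1 expr1n mulr1 => /(le_trans _); apply.
  by rewrite le_eqVlt; apply/orP; left; apply/eqP/eq_Rintegral => w _;
    rewrite mul0r oppr0 expR0.
have M := @Rintegral_sqr_expR_N0half_le _ _ _ _ _ (hY (j, false)) t t0.
have J0 : (0 < #|J|)%N by apply/card_gt0P; exists j.
rewrite -mulrA.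
apply: (@le_trans _ _ (2^-1 * ((2 * s ^+ 3)^-1 * s^-1 ^+ #|J|.-1))).
  apply: ler_pM => //.
  - by apply: Rintegral_ge0 => w _; rewrite mulr1 sqr_ge0.
  - apply: mulr_ge0; last by rewrite exprn_ge0// invr_ge0 ltW.
    by apply: Rintegral_ge0 => w _; rewrite mulr_ge0 ?sqr_ge0 ?expR_ge0.
  - by rewrite ler_wpM2r// exprn_ge0// invr_ge0 ltW.
rewrite le_eqVlt; apply/orP; left; apply/eqP.
by rewrite /q -{2}(prednK J0) !(exprS _^-1); field; rewrite gt_eqF.
Qed.

End quadratic_form.

(** * From the exponential weight to the ratio of quadratic forms *)

(** Writing [x^-1 = x (x^2)^-1] reduces the inverse to a real power of a nonnegative number; at
    [x = 0] both sides are 0. *)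
Lemma measurable_funVr {R : realType} d (T : measurableType d) (f : T -> R) :
  measurable_fun [set: T] f -> measurable_fun [set: T] (fun x => (f x)^-1).
Proof.
move=> mf; rewrite (_ : (fun x => _) = fun x => f x * powR (f x ^+ 2) (-1)).
  apply: measurable_funM => //; apply: (measurableT_comp (measurable_powR _)).
  exact: measurable_funX.
apply/funext => x; rewrite powR_inv1 ?sqr_ge0//.
have [->|fx] := eqVneq (f x) 0; first by rewrite invr0 mul0r.
by field.
Qed.

(** The sets are extended by [setT] outside the image of [phi], which adds only factors of
    probability 1. *)
Lemma mutually_independent_inj {R : realType} d (T : measurableType d)
    (P : probability T R) (I J : finType) (X : I -> {RV P >-> R}) (phi : J -> I) :
  injective phi -> mutually_independent X ->
  mutually_independent (fun j => X (phi j)).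
Proof.
move=> phiI indX A mA.
pose A' i := if [pick j | phi j == i] is Some j then A j else setT.
have A'phi j : A' (phi j) = A j.
  rewrite /A'; case: pickP => [k /eqP /phiI -> //|/(_ j)].
  by rewrite eqxx.
have A'out i : i \notin codom phi -> A' i = setT.
  rewrite /A'; case: pickP => // k /eqP <-.
  by rewrite codom_f.
have mA' i : measurable (A' i).
  by rewrite /A'; case: pickP.
have -> : \bigcap_(j in [set: J]) (X (phi j) @^-1` A j) =
          \bigcap_(i in [set: I]) (X i @^-1` A' i).
  apply/seteqP; split=> w H i _.
    have [/codomP[j ->]|/A'out ->] := boolP (i \in codom phi); last by [].
    by rewrite A'phi; exact: H.
  by rewrite /preimage /= -A'phi; exact: (H (phi i) Logic.I).
rewrite indX// (bigID (mem (codom phi)))/= [X in (_ * X)%E]big1 ?mule1; last first.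
  by move=> i /A'out ->; rewrite preimage_setT probability_setT.
rewrite (reindex_omap phi (fun i => [pick j | phi j == i])); last first.
  move=> i /codomP[j ->]; case: pickP => [k /eqP /= -> //|/(_ j)].
  by rewrite eqxx.
apply: eq_big => [j|j _]; last by rewrite A'phi.
rewrite codom_f; case: pickP => [k /eqP /phiI ->|/(_ j)]; first by rewrite eqxx.
by rewrite eqxx.
Qed.

Section bilinear_ratio.
Context {R : realType} d (T : measurableType d) (P : probability T R).
Variables (J : finType) (Y : J * bool -> {RV P >-> R}) (eps : J -> R) (n : nat).
Hypothesis indY : mutually_independent Y.
Hypothesis hY : forall m, has_law_N0half _ _ _ (Y m).
Hypothesis eps1 : forall j, eps j ^+ 2 = 1.
Hypothesis n0 : (0 < n)%N.
Hypothesis Jn : #|J| = n.+1.*2.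

Let L w := \sum_j eps j * Y (j, false) w * Y (j, true) w.
Let S w := \sum_j Y (j, false) w ^+ 2.

Let mL : measurable_fun [set: T] L.
Proof.
apply: measurable_sum => j; apply: measurable_funM => //.
by apply: measurable_funM => //; exact: measurable_cst.
Qed.

Let mS : measurable_fun [set: T] S.
Proof. by apply: measurable_sum => j; exact: measurable_funX. Qed.

(** Since [#|J| = 2 (n + 1)], the bound under the [t] integral is [(n + 1) / 2] times
    [t (1 + t)^-(n + 2)], without square root, and it integrates to [(n + 1) / 2 * 1 / (n (n + 1)) =
    1 / (2 n)]. *)
Lemma integral_sqr_bilinear_ratio_le :
  (\int[P]_w (L w ^+ 2 / S w ^+ 2)%:E <= ((2 * n%:R)^-1)%:E)%E.
Proof.
pose D := `[0%R, +oo[%classic : set (measurableTypeR R).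
(* The indicator of the half-line is part of the integrand, so that Tonelli applies on the whole
   product space. *)
pose F (z : T * measurableTypeR R) : \bar R :=
  (\1_D z.2 * (z.2 * (L z.1 ^+ 2 * expR (- (z.2 * S z.1)))))%:E.
have mF : measurable_fun [set: T * measurableTypeR R] F.
  have m2 : measurable_fun [set: T * measurableTypeR R] (fun z => z.2 : R).
    exact: measurable_snd.
  apply/measurable_EFinP; apply: measurable_funM.
    apply: measurableT_comp => //; apply: measurable_indic.
    exact: measurable_itv.
  apply: measurable_funM => //; apply: measurable_funM.
    by apply: measurable_funX; exact: measurableT_comp.
  apply: measurableT_comp => //; apply: measurableT_comp => //.
  by apply: measurable_funM => //; exact: measurableT_comp.
have F0 z : (0 <= F z)%E.
  rewrite lee_fin indicE; case: (boolP (_ \in _)); last by rewrite mul0r.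
  rewrite inE /D /= in_itv /= andbT => z0.
  by rewrite mul1r mulr_ge0// mulr_ge0 ?sqr_ge0 ?expR_ge0.
have S0 w : 0 <= S w by apply: sumr_ge0 => j _; exact: sqr_ge0.
have ratioE w : (L w ^+ 2 / S w ^+ 2)%:E = (\int[lebesgue_measure]_t F (w, t))%E.
  transitivity ((L w ^+ 2)%:E *
      \int[lebesgue_measure]_(t in `[0%R, +oo[) (t * expR (- (t * S w)))%:E)%E.
    have [Sw0|Sw0] := eqVneq (S w) 0; last first.
      by rewrite integral_id_expR// lt_def Sw0 S0.
    suff -> : L w = 0 by rewrite expr0n /= mul0r mul0e.
    rewrite /L big1// => j _; have /eqP : Y (j, false) w ^+ 2 = 0.
      have /psumr_eq0P : forall j, true -> 0 <= Y (j, false) w ^+ 2.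
        by move=> *; exact: sqr_ge0.
      exact.
    by rewrite sqrf_eq0 => /eqP ->; rewrite mulr0 mul0r.
  rewrite -ge0_integralZl//; last 3 first.
  - apply: measurable_funTS; apply/measurable_EFinP; apply: measurable_funM => //.
    apply: measurableT_comp => //; apply: measurableT_comp => //.
    exact: measurable_funM.
  - by move=> t /=; rewrite in_itv/= andbT => t0; rewrite lee_fin mulr_ge0 ?expR_ge0.
  - by rewrite lee_fin sqr_ge0.
  rewrite integral_mkcond.
  apply: eq_integral => t _; rewrite epatch_indic /F /D /=.
  rewrite -!EFinM.
  by congr EFin; ring.
have mker : measurable_fun [set: R] (fun t : R => (t * (1 + t) ^- n.+2)%:E).
  apply/measurable_EFinP; apply: measurable_funM => //; apply: measurable_funVr.
  by apply: measurable_funX; exact: measurable_funD.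
under eq_integral do rewrite ratioE.
rewrite (@fubini_tonelli _ _ _ _ _ P lebesgue_measure F)//.
apply: (@le_trans _ _ (\int[lebesgue_measure]_(t in `[0%R, +oo[)
    ((n.+1%:R / 2)%:E * (t * (1 + t) ^- n.+2)%:E))%E); last first.
  rewrite ge0_integralZl//; last 2 first.
  - exact: measurable_funTS.
  - move=> t; rewrite /= in_itv/= andbT => t0.
    by rewrite lee_fin mulr_ge0 ?invr_ge0 ?exprn_ge0//; lra.
  rewrite integral_id_expV// lee_fin le_eqVlt; apply/orP; left; apply/eqP.
  have nN0 : n%:R != 0 :> R by rewrite pnatr_eq0 -lt0n.
  have n1 : n%:R + 1 != 0 :> R by rewrite natr1 pnatr_eq0.
  by rewrite -natr1; field; rewrite nN0 n1.
rewrite [leRHS]integral_mkcond; apply: ge0_le_integral => //.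
- by move=> t _; apply: integral_ge0.
- exact: measurable_fun_fubini_tonelli_G.
- apply/(measurable_restrictT _ _).1 => //.
  by apply: measurable_funTS; exact: emeasurable_funM.
move=> t _; rewrite epatch_indic /=.
have [tD|tD] := boolP (t \in D); last first.
  rewrite [leLHS](_ : _ = 0%E).
    by rewrite indicE (negPf tD) mule0.
  by apply: integral0_eq => w _; rewrite /F indicE /= (negPf tD) mul0r.
have t0 : 0 <= t by move: tD; rewrite inE /D /= in_itv /= andbT.
rewrite indicE tD mule1.
have s0 : 0 < 1 + t by lra.
have -> : (\int[P]_w F (w, t) =
    t%:E * \int[P]_w (L w ^+ 2 * expR (- (t * S w)))%:E)%E.
  rewrite -ge0_integralZl//; last 2 first.
  - apply/measurable_EFinP; apply: measurable_funM; first exact: measurable_funX.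
    apply: measurableT_comp => //; apply: measurableT_comp => //.
    exact: measurable_funM.
  - by move=> w _; rewrite lee_fin mulr_ge0 ?sqr_ge0 ?expR_ge0.
  by apply: eq_integral => w _; rewrite /F /= indicE tD mul1r EFinM.
have t0E : (0 <= t%:E)%E by rewrite lee_fin.
apply: (le_trans (lee_wpmul2l t0E
  (@integral_sqr_bilinear_expR_le _ _ _ _ _ _ eps indY hY eps1 t t0))).
rewrite -!EFinM lee_fin Jn le_eqVlt; apply/orP; left; apply/eqP.
have -> : (Num.sqrt (1 + t))^-1 ^+ n.+1.*2.+2 = (1 + t) ^- n.+2.
  by rewrite -doubleS -mul2n exprM exprVn sqr_sqrtr ?exprVn// ltW.
by rewrite -mul2n natrM; field; rewrite expf_neq0// gt_eqF.
Qed.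

End bilinear_ratio.

(** * Entries of the Gram matrix and the Frobenius norm *)

Definition gram_diag {R : realType} {T : Type} {B U : nat}
    (X : 'I_B * 'I_U * bool -> T -> R) (i : 'I_U) (w : T) : R :=
  \sum_(p : 'I_B * bool) X (p.1, i, p.2) w ^+ 2.

(* The factor [1] is the coefficient [eps] of [integral_sqr_bilinear_ratio_le]. *)
Definition gram_re {R : realType} {T : Type} {B U : nat}
    (X : 'I_B * 'I_U * bool -> T -> R) (i j : 'I_U) (w : T) : R :=
  \sum_(p : 'I_B * bool) 1 * X (p.1, i, p.2) w * X (p.1, j, p.2) w.

(** From [Im(conj(x) y) = Re x Im y - Im x Re y]: the sign is negative when the factor from column
    [i] is an imaginary part. *)
Definition gram_im {R : realType} {T : Type} {B U : nat}
    (X : 'I_B * 'I_U * bool -> T -> R) (i j : 'I_U) (w : T) : R :=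
  \sum_(p : 'I_B * bool) (-1) ^+ p.2 * X (p.1, i, p.2) w * X (p.1, j, ~~ p.2) w.

Lemma EmatE {R : rcfType} (U : nat) (M : 'M[R[i]]_U) i j :
  Emat M i j = M i j - M i i *+ (i == j).
Proof. by rewrite /Emat /Dmat !mxE. Qed.

Section matrix_form.
Context {R : realType} {T : Type} {B U : nat}.
Variables (X : 'I_B * 'I_U * bool -> T -> R) (N0 Es : R) (w : T).

Let A : 'M[R[i]]_U := Amat (Hmat X w) N0 Es.

Lemma Amat_HmatE i j : A i j =
  Complex (gram_re X i j w + (N0 / Es) *+ (i == j)) (gram_im X i j w).
Proof.
rewrite /A /Amat /ctrmx mxE [X in X + _]mxE [X in _ + X]mxE.
rewrite /gram_re /gram_im.
rewrite -(pair_bigA _ (fun b c => 1 * X (b, i, c) w * X (b, j, c) w))/=.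
rewrite -(pair_bigA _ (fun b c => (-1) ^+ (c : bool) * X (b, i, c) w * X (b, j, ~~ c) w))/=.
have -> : \sum_b (map_mx conjc (Hmat X w))^T i b * Hmat X w b j =
   Complex (\sum_b \sum_(c : bool) 1 * X (b, i, c) w * X (b, j, c) w)
     (\sum_b \sum_(c : bool) (-1) ^+ c * X (b, i, c) w * X (b, j, ~~ c) w).
  elim/big_ind3 : _ => [//|x1 x2 x3 y1 y2 y3 -> ->//|b _].
  rewrite !mxE !big_bool /= expr0 expr1.
  by simpc; congr Complex; ring.
rewrite mulrb; case: eqP => _; rewrite ?mulr1n ?mulr0n; simpc => //.
Qed.

Lemma gram_re_diag i : gram_re X i i w = gram_diag X i w.
Proof. by apply: eq_bigr => p _; rewrite mul1r expr2. Qed.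

Lemma gram_im_diag i : gram_im X i i w = 0.
Proof.
rewrite /gram_im.
rewrite -(pair_bigA _ (fun b c => (-1) ^+ (c : bool) * X (b, i, c) w * X (b, i, ~~ c) w))/=.
by apply: big1 => b _; rewrite big_bool /= expr0 expr1; ring.
Qed.

Let del i := gram_diag X i w + N0 / Es.

(* [invmx D] is [D] itself when [D] is singular. *)
Definition inv_coef i := if [forall k, del k != 0] then (del i)^-1 else del i.

Lemma invmx_DmatE : invmx (Dmat A) = diag_mx (\row_i (inv_coef i)%:C%C).
Proof.
have DE : Dmat A = diag_mx (\row_i (del i)%:C%C).
  rewrite /Dmat; congr diag_mx; apply/rowP => i.
  by rewrite [LHS]mxE [RHS]mxE Amat_HmatE eqxx gram_re_diag gram_im_diag mulr1n.
rewrite DE /inv_coef; have [/forallP del0|] := boolP [forall k, del k != 0].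
  have unitD : diag_mx (\row_i (del i)%:C%C) \in unitmx.
    rewrite unitmxE det_diag unitfE; apply/prodf_neq0 => i _.
    by rewrite mxE; apply: contra_neq (del0 i) => /complexI.
  rewrite -[RHS](mulKmx unitD) mulmx_diag.
  rewrite (_ : diag_mx _ = 1%:M) ?mulmx1//.
  rewrite -diag_const_mx; congr diag_mx; apply/rowP => i.
  by rewrite !mxE -rmorphM/= mulfV.
rewrite negb_forall => /existsP[k]; rewrite negbK => /eqP dk.
rewrite invmx_out// inE unitmxE det_diag unitfE negbK.
by apply/eqP; rewrite (bigD1 k)//= mxE dk mul0r.
Qed.

(** The diagonal of [Emat A] is zero, and left multiplication by a real diagonal matrix scales each
    squared modulus by the square of its coefficient. This covers singular [D] too. *)
Lemma frob_DinvE : frob (invmx (Dmat A) *m Emat A) =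
  Num.sqrt (\sum_i \sum_(j | j != i)
    inv_coef i ^+ 2 * (gram_re X i j w ^+ 2 + gram_im X i j w ^+ 2)).
Proof.
rewrite /frob invmx_DmatE mul_diag_mx; congr Num.sqrt.
apply: eq_bigr => i _; rewrite [RHS]big_mkcond/=; apply: eq_bigr => j _.
rewrite [X in let: Complex _ _ := X in _]mxE EmatE mxE.
case: (eqVneq j i) => [->|ji] /=.
  by rewrite ?eqxx mulr1n subrr mulr0 /= expr0n addr0.
rewrite Amat_HmatE ?(eq_sym i j) (negPf ji) ?mulr0n subr0 addr0.
by simpc; ring.
Qed.

End matrix_form.

(** * Moments of the normalized Gram entries *)

Section gram_bounds.
Context {R : realType} d (T : measurableType d) (P : probability T R).
Context {B U : nat} (X : 'I_B * 'I_U * bool -> {RV P >-> R}).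
Hypothesis B4 : (4 < B)%N.
Hypothesis indX : mutually_independent X.
Hypothesis hX : forall k, has_law_N0half _ _ _ (X k).

Let Xf k : T -> R := X k.

Lemma measurable_gram_diag i : measurable_fun [set: T] (gram_diag Xf i).
Proof. by apply: measurable_sum => p; exact: measurable_funX. Qed.

Lemma measurable_gram_re i j : measurable_fun [set: T] (gram_re Xf i j).
Proof.
apply: measurable_sum => p; apply: measurable_funM => //.
by apply: measurable_funM => //; exact: measurable_cst.
Qed.

Lemma measurable_gram_im i j : measurable_fun [set: T] (gram_im Xf i j).
Proof.
apply: measurable_sum => p; apply: measurable_funM => //.
by apply: measurable_funM => //; exact: measurable_cst.
Qed.

Let cardJ : #|{: 'I_B * bool}| = (B.-1).+1.*2.
Proof. by rewrite card_prod card_ord card_bool muln2; case: B B4. Qed.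

Let B1 : (0 < B.-1)%N.
Proof. by case: B B4 => // -[]. Qed.

(** Rearranges two columns into the form required by the bilinear lemma: [m.2] selects the column,
    and [s] swaps real and imaginary parts in column [j], as in [gram_im]. *)
Let phi (i j : 'I_U) (s : bool) (m : ('I_B * bool) * bool) : 'I_B * 'I_U * bool :=
  if m.2 then (m.1.1, j, if s then ~~ m.1.2 else m.1.2) else (m.1.1, i, m.1.2).

Let phi_inj i j s : i != j -> injective (phi i j s).
Proof.
move=> ij [[b c] e] [[b' c'] e']; rewrite /phi /=.
have ji : j != i by rewrite eq_sym.
case: e; case: e' => /= E; move/(congr1 (fun p => p.1.1)): (E) => /= bE;
  move/(congr1 (fun p => p.1.2)): (E) => /= uE; move/(congr1 snd): E => /= cE.
- by move: cE; rewrite bE; case: s; case: c; case: c'.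
- by move: ji; rewrite uE eqxx.
- by move: ij; rewrite uE eqxx.
- by rewrite bE cE.
Qed.

Lemma integral_gram_re_le i j : i != j ->
  (\int[P]_w (gram_re Xf i j w ^+ 2 / gram_diag Xf i w ^+ 2)%:E <=
   ((2 * (B.-1)%:R)^-1)%:E)%E.
Proof.
move=> ij; apply: (@integral_sqr_bilinear_ratio_le _ _ _ P _
  (fun m => X (phi i j false m)) (fun=> 1)) => //.
- apply: (@mutually_independent_inj _ _ _ P _ _ X (phi i j false)) => //.
  exact: phi_inj.
- by move=> ?; rewrite expr1n.
Qed.

Lemma integral_gram_im_le i j : i != j ->
  (\int[P]_w (gram_im Xf i j w ^+ 2 / gram_diag Xf i w ^+ 2)%:E <=
   ((2 * (B.-1)%:R)^-1)%:E)%E.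
Proof.
move=> ij; apply: (@integral_sqr_bilinear_ratio_le _ _ _ P _
  (fun m => X (phi i j true m)) (fun p => (-1) ^+ p.2)) => //.
- apply: (@mutually_independent_inj _ _ _ P _ _ X (phi i j true)) => //.
  exact: phi_inj.
- by move=> p; rewrite sqrr_sign.
Qed.

(** If a squared column norm vanishes, so does the real part of its first entry, an event of
    probability 0 because the normal law has a density. Finitely many columns are then combined. *)
Lemma gram_diag_gt0_ae : {ae P, forall w, forall i, 0 < gram_diag Xf i w}.
Proof.
have b0 : 'I_B by apply: (@Ordinal B 0); case: B B4.
have mE i : measurable (Xf (b0, i, false) @^-1` [set 0]).
  by rewrite -[X in measurable X]setTI; exact: measurable_funPT.
have pos i : {ae P, forall w, 0 < gram_diag Xf i w}.
  exists (Xf (b0, i, false) @^-1` [set 0]); split => //.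
    apply: (etrans (hX (b0, i, false) _ (measurable_set1 0))).
    by rewrite /normal_prob integral_set1.
  move=> w /= /negP; rewrite -leNgt => S0.
  have : Xf (b0, i, false) w ^+ 2 <= 0.
    apply: le_trans S0; rewrite /gram_diag (bigD1 (b0, false))//= lerDl.
    by apply: sumr_ge0 => p _; exact: sqr_ge0.
  by move=> H; apply/eqP; rewrite -sqrf_eq0 eq_le H sqr_ge0.
exact: filter_forall.
Qed.

End gram_bounds.

(** * Elementary inequalities and the Markov bound *)

(** Both inequalities say [sqrt q < alpha^(1/K)], raised to the power [K] on the left and 2 on the
    right. *)
Lemma sqrt_exp_lt {R : realType} (q alpha : R) (K : nat) :
  (1 <= K)%N -> 0 < alpha -> 0 <= q ->
  (Num.sqrt q ^+ K < alpha) = (q < powR alpha (2 / K%:R)).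
Proof.
move=> K1 a0 q0; have K0 : K%:R != 0 :> R by rewrite pnatr_eq0 -lt0n.
set be := powR alpha K%:R^-1.
have be0 : 0 <= be by exact: powR_ge0.
have aE : alpha = be ^+ K by rewrite -powR_mulrn// -powRrM mulVf// powRr1// ltW.
have a2 : powR alpha (2 / K%:R) = be ^+ 2.
  by rewrite -powR_mulrn// -powRrM mulrC.
rewrite a2 [in LHS]aE ltr_pXn2r ?nnegrE ?sqrtr_ge0//.
by rewrite -[in RHS](sqr_sqrtr q0) ltr_pXn2r ?nnegrE ?sqrtr_ge0.
Qed.

(** After squaring and clearing denominators, both sides are compared with [(b - 1)^4]: the product
    of the four factors is below it, and [(b - 1)^2 <= 2 b (b + 1)]. *)
Lemma inv_le_fourth_moment_bound {R : realType} (b : R) : 5 <= b ->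
  (b - 1)^-1 <= Num.sqrt ((2 * b * (b + 1)) /
               ((b - 1) * (b - 2) * (b - 3) * (b - 4))).
Proof.
move=> b5.
have b1 : 0 < b - 1 by lra.
have D0 : 0 < (b - 1) * (b - 2) * (b - 3) * (b - 4).
  by rewrite !mulr_gt0//; lra.
have i0 : 0 <= (b - 1)^-1 by rewrite invr_ge0 ltW.
rewrite -(ger0_norm i0) -sqrtr_sqr ler_sqrt; last first.
  by rewrite divr_ge0 ?(ltW D0)// mulr_ge0//; lra.
rewrite exprVn ler_pdivlMr// mulrC ler_pdivrMr ?exprn_gt0//.
apply: (@le_trans _ _ ((b - 1) * (b - 1) * (b - 1) * (b - 1))).
  by rewrite !ler_pM ?mulr_ge0//; lra.
rewrite (_ : _ * (b - 1) = (b - 1) ^+ 2 * (b - 1) ^+ 2); last by ring.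
by rewrite ler_wpM2r ?sqr_ge0//; nra.
Qed.

Theorem theorem1 (R : realType) (d : measure_display) (T : measurableType d)
  (P : probability T R) (B U : nat)
  (X : 'I_B * 'I_U * bool -> {RV P >-> R})
  (N0 Es : R) (K : nat) (alpha : R) :
  (4 < B)%N -> (1 <= U)%N -> 0 <= N0 -> 0 < Es ->
  (* real and imaginary parts of the entries of H: i.i.d. N(0, 1/2),
     i.e. the entries are i.i.d. CN(0,1) *)
  mutually_independent X ->
  (forall k (A : set R), measurable A ->
     distribution P (X k) A = normal_prob 0 (Num.sqrt (2^-1)) A) ->
  (1 <= K)%N -> 0 < alpha ->
  ((1 - (U%:R ^+ 2 - U%:R) / powR alpha (2 / K%:R) *
     Num.sqrt ((2 * B%:R * (B%:R + 1)) /
               ((B%:R - 1) * (B%:R - 2) * (B%:R - 3) * (B%:R - 4))))%:E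
   <= P [set w | (frob (invmx (Dmat (Amat (Hmat (fun k => X k) w) N0 Es))
                        *m Emat (Amat (Hmat (fun k => X k) w) N0 Es)) ^+ K < alpha)%R])%E.
Proof.
move=> B4 U1 N00 Es0 indX hX K1 a0.
pose Xf k : T -> R := X k.
pose c := N0 / Es.
have c0 : 0 <= c by rewrite divr_ge0// ltW.
pose Z i j w := gram_re Xf i j w ^+ 2 + gram_im Xf i j w ^+ 2.
have Z0 i j w : 0 <= Z i j w by rewrite addr_ge0// sqr_ge0.
have mZ i j : measurable_fun [set: T] (Z i j).
  apply: measurable_funD; apply: measurable_funX.
    exact: measurable_gram_re.
  exact: measurable_gram_im.
(* [q] is exactly the squared Frobenius norm; [Q] is its almost sure majorant, in which [N0 / Es] no
   longer appears. *)
pose q w := \sum_i \sum_(j | j != i) inv_coef Xf N0 Es w i ^+ 2 * Z i j w.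
pose Q w := \sum_i \sum_(j | j != i) Z i j w / gram_diag Xf i w ^+ 2.
pose ep := powR alpha (2 / K%:R).
have ep0 : 0 < ep by exact: powR_gt0.
have q0 w : 0 <= q w.
  by apply: sumr_ge0 => i _; apply: sumr_ge0 => j _; rewrite mulr_ge0// sqr_ge0.
have Q0 w : 0 <= Q w.
  by apply: sumr_ge0 => i _; apply: sumr_ge0 => j _; rewrite divr_ge0// sqr_ge0.
have mdel i : measurable_fun [set: T] (fun w => gram_diag Xf i w + c).
  by apply: measurable_funD => //; exact: measurable_gram_diag.
have mr i : measurable_fun [set: T] (fun w => inv_coef Xf N0 Es w i).
  apply: measurable_fun_ifT.
  (* The boolean test that all diagonal entries are nonzero becomes positivity of the square of
     their product, a measurable comparison. *)
  - rewrite (_ : (fun w => _) = fun w => 0 < (\prod_k (gram_diag Xf k w + c)) ^+ 2).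
      apply: measurable_fun_ltr => //; apply: measurable_funX.
      by apply: measurable_prod => k _; exact: mdel.
    apply/funext => w; rewrite exprn_even_gt0//=.
    by apply/forallP/prodf_neq0 => [H k _|H k]; exact: H.
  - exact: measurable_funVr.
  - exact: mdel.
have msum1 (G : 'I_U -> T -> R) i :
    (forall j, measurable_fun [set: T] (G j)) ->
    measurable_fun [set: T] (fun w => \sum_(j | j != i) G j w).
  move=> mG.
  rewrite (_ : (fun w => _) =
      (fun w => \sum_(j <- [seq j <- index_enum 'I_U | j != i]) G j w)).
    by apply: measurable_sum => j.
  by apply/funext => w; rewrite big_filter.
have mq : measurable_fun [set: T] q.
  apply: measurable_sum => i; apply: msum1 => j; apply: measurable_funM => //.
  exact: measurable_funX.
have mQ : measurable_fun [set: T] Q.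
  apply: measurable_sum => i; apply: msum1 => j; apply: measurable_funM => //.
  by apply: measurable_funVr; apply: measurable_funX; exact: measurable_gram_diag.
have frobE w : (frob (invmx (Dmat (Amat (Hmat Xf w) N0 Es))
    *m Emat (Amat (Hmat Xf w) N0 Es)) ^+ K < alpha)%R = (q w < ep).
  by rewrite frob_DinvE; exact: (@sqrt_exp_lt _ (q w)).
have -> : [set w | (frob (invmx (Dmat (Amat (Hmat (fun k => X k) w) N0 Es))
    *m Emat (Amat (Hmat (fun k => X k) w) N0 Es)) ^+ K < alpha)%R] =
    ~` [set w | ep <= q w].
  apply/seteqP; split => w /=; rewrite frobE.
    by move=> H; apply/negP; rewrite -ltNge.
  by move/negP; rewrite -ltNge.
have mE : measurable [set w | ep <= q w].
  rewrite -[X in measurable X]setTI.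
  have := mq measurableT `[ep, +oo[%classic (measurable_itv _).
  congr (measurable (_ `&` _)); apply/seteqP; split => w /=; by rewrite in_itv/= andbT.
rewrite probability_setC//.
(* There are [U^2 - U] ordered pairs [i != j]; real and imaginary parts contribute at most
   [1 / (2 (B - 1))] each. *)
have intQ : (\int[P]_w (Q w)%:E <= ((U%:R ^+ 2 - U%:R) / (B.-1)%:R)%:E)%E.
  pose G i j w := Z i j w / gram_diag Xf i w ^+ 2.
  have G0 i j w : 0 <= G i j w by rewrite divr_ge0// sqr_ge0.
  have mS2 i : measurable_fun [set: T] (fun w => (gram_diag Xf i w ^+ 2)^-1).
    by apply: measurable_funVr; apply: measurable_funX; exact: measurable_gram_diag.
  have mG i j : measurable_fun [set: T] (fun w => (G i j w)%:E).
    by apply/measurable_EFinP; exact: measurable_funM.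
  have intG i j : j != i -> (\int[P]_w (G i j w)%:E <= ((B.-1)%:R^-1)%:E)%E.
    rewrite eq_sym => ij; rewrite /G /Z.
    under eq_integral do rewrite mulrDl EFinD.
    rewrite ge0_integralD//.
    - apply: (le_trans (leeD (@integral_gram_re_le _ _ _ P _ _ X B4 indX hX _ _ ij)
        (@integral_gram_im_le _ _ _ P _ _ X B4 indX hX _ _ ij))).
      rewrite -EFinD lee_fin invfM -mulrDl.
      by rewrite -[leRHS]mul1r ler_wpM2r ?invr_ge0//; lra.
    - by move=> w _; rewrite lee_fin divr_ge0// sqr_ge0.
    - apply/measurable_EFinP; apply: measurable_funM => //.
      by apply: measurable_funX; exact: measurable_gram_re.
    - by move=> w _; rewrite lee_fin divr_ge0// sqr_ge0.
    - apply/measurable_EFinP; apply: measurable_funM => //.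
      by apply: measurable_funX; exact: measurable_gram_im.
  under eq_integral do rewrite /Q -sumEFin.
  rewrite ge0_integral_sum//; last 2 first.
  - by move=> i; apply/measurable_EFinP/msum1 => j; exact: measurable_funM.
  - by move=> i w _; rewrite lee_fin; apply: sumr_ge0 => j _; exact: G0.
  apply: (@le_trans _ _ (\sum_(i : 'I_U) \sum_(j | j != i) ((B.-1)%:R^-1)%:E)%E).
    apply: lee_sum => i _.
    under eq_integral do rewrite -sumEFin -big_filter.
    rewrite (@ge0_integral_sum _ _ _ P setT measurableT _
      (fun j w => (G i j w)%:E) (mG i)); last first.
      by move=> j w _; rewrite lee_fin.
    by rewrite big_filter; apply: lee_sum => j ji; exact: intG.
  under eq_bigr do rewrite sumEFin.
  rewrite sumEFin lee_fin.
  under eq_bigr do rewrite sumr_const cardC1 card_ord.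
  rewrite sumr_const card_ord -mulrnA -(mulr_natl (B.-1)%:R^-1) le_eqVlt.
  apply/orP; left; apply/eqP; congr (_ / _).
  have UE : U%:R = (U.-1)%:R + 1 :> R by rewrite natr1 prednK.
  by rewrite natrM UE; ring.
(* The comparison holds where all column norms are positive: there [D] is invertible and its entries
   are at least [gram_diag], since [N0 / Es >= 0]. *)
have qQ : (\int[P]_w (q w)%:E <= \int[P]_w (Q w)%:E)%E.
  apply: ae_ge0_le_integral => //.
  - by move=> w _; rewrite lee_fin.
  - exact/measurable_EFinP.
  - by move=> w _; rewrite lee_fin.
  - exact/measurable_EFinP.
  apply: filterS (@gram_diag_gt0_ae _ _ _ P _ _ X B4 hX) => w S0 _.
  rewrite lee_fin; apply: ler_sum => i _; apply: ler_sum => j _.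
  have del0 k : gram_diag Xf k w + N0 / Es != 0.
    by rewrite gt_eqF// ltr_wpDr//; exact: S0.
  rewrite /inv_coef (_ : [forall k, _]) => [|]; last exact/forallP.
  have g0 : 0 < gram_diag Xf i w := S0 i.
  have d0 : 0 < gram_diag Xf i w + N0 / Es by rewrite ltr_wpDr.
  rewrite mulrC exprVn ler_wpM2l// lef_pV2 ?posrE ?exprn_gt0//.
  by rewrite lerXn2r ?nnegrE ?lerDl// ltW.
(* Markov's inequality for the nonnegative variable [q] at level [ep]. *)
have mark : (ep%:E * P [set w | ep <= q w]%R <= \int[P]_w (q w)%:E)%E.
  have /= := @le_integral_comp_abse _ _ _ P setT measurableT (EFin \o q) ep id.
  rewrite setTI => H.
  under [leRHS]eq_integral do rewrite -(ger0_norm (q0 _)).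
  apply: le_trans (H _ _ _ _ _) => //.
  - rewrite le_eqVlt; apply/orP; left; apply/eqP; congr (_ * P _)%E.
    by apply/seteqP; split=> w /=; rewrite lee_fin ger0_norm.
  - exact/measurable_EFinP.
have PEfin : P [set w | ep <= q w] \is a fin_num by rewrite fin_num_measure.
have : (ep%:E * P [set w | (ep <= q w)%R] <=
    ((U%:R ^+ 2 - U%:R) / (B.-1)%:R)%:E)%E.
  exact: le_trans mark (le_trans qQ intQ).
rewrite -(fineK PEfin); set p := fine _; rewrite -EFinM lee_fin => pB.
rewrite -EFinB lee_fin lerD2l lerN2.
have U2 : 0 <= U%:R ^+ 2 - U%:R :> R.
  by rewrite subr_ge0 expr2 ler_peMr// ler1n.
have BE : (B.-1)%:R = B%:R - 1 :> R by rewrite -subn1 natrB// (leq_trans _ B4).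
rewrite mulrAC ler_pdivlMr//; apply: (le_trans (y := (U%:R ^+ 2 - U%:R) / (B.-1)%:R)).
  by rewrite mulrC.
rewrite ler_wpM2l// BE; apply: inv_le_fourth_moment_bound.
by rewrite ler_nat.
Qed.
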